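(* Let $m,n$ be coprime positive integers and let $\mathcal X_{3,\kappa}^*$ be a $2$-dimensional component of the irreducible locus of the $\mathrm{SL}(3,\mathbb C)$-character variety $\mathcal X_3$ of the torus knot $K_{m,n}$, so that $\mathcal X_{3,\kappa}^*\cong\mathbb C^2-(\{x=0\}\cup\{y=0\}\cup\{x+y=1\})$. Then its closure in $\mathcal X_3$ is $\overline{\mathcal X_{3,\kappa}^*}=\mathbb C^2$. The closure consists of adding three lines of partially reducible representations that intersect pairwise. The three intersection points are precisely the totally reducible representations.
   Context: The knot group is $\Gamma=\langle x,y\mid x^n=y^m\rangle$; $\mathcal X_3$ is the affine GIT quotient by conjugation of the set of pairs $(A,B)\in\mathrm{SL}(3,\mathbb C)^2$ with $A^n=B^m$; its points are classes of semisimple representations. The $2$-dimensional components $\mathcal X^*_{3,\kappa}$ of the irreducible locus are obtained by fixing the eigenvalues (with multiplicity) of $A$ and $B$ such that one of $A,B$ has exactly one repeated eigenvalue (multiplicity two) and the other has three distinct eigenvalues. A semisimple representation is partially reducible if it is the sum of an irreducible two-dimensional and a one-dimensional representation, and totally reducible if it is a sum of three one-dimensional representations. *)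

(* Defs.v *)
From HB Require Import structures.
From mathcomp Require Import all_boot all_order all_algebra.
From mathcomp Require Import boolp classical_sets functions reals.
From mathcomp.real_closed Require Import complex.
From mathcomp Require Import mpoly.

Set Implicit Arguments.
Unset Strict Implicit.
Unset Printing Implicit Defensive.

Import GRing.Theory.
Local Open Scope ring_scope.
Local Open Scope classical_set_scope.

(* A pair [(A, B)] of [k x k] matrices is viewed through its entries as a point
   of affine space of dimension [k * k + k * k]. *)
Definition entries (F : fieldType) (k : nat) (A B : 'M[F]_k)
    (i : 'I_(k * k + k * k)) : F :=
  row_mx (mxvec A) (mxvec B) 0 i.

Definition pair_conj (F : fieldType) (k : nat) (A B A' B' : 'M[F]_k) : Prop :=
  exists2 P : 'M[F]_k, P \in unitmx &
    A' = P *m A *m invmx P /\ B' = P *m B *m invmx P.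

(* The [k]-dimensional representation given by the invertible matrices [A], [B]
   is irreducible: it is nonzero and its only subrepresentations are 0 and the
   whole space.  Subspaces are row spaces; passing to column vectors replaces
   the representation by its dual, which does not affect irreducibility. *)
Definition pair_irreducible (F : fieldType) (k : nat) (A B : 'M[F]_k) : Prop :=
  (0 < k)%N /\
  forall V : 'M[F]_k, stablemx V A -> stablemx V B ->
    (V == 0) || row_full V.

Definition has_eigenvalues (F : fieldType) (k : nat) (A : 'M[F]_k)
    (s : k.-tuple F) : Prop :=
  char_poly A = \prod_(a <- s) ('X - a%:P).

Definition one_double_eigenvalue (F : fieldType) (s : 3.-tuple F) : Prop :=
  exists a b : F, a != b /\ perm_eq s [:: a; a; b].

Definition three_distinct_eigenvalues (F : fieldType) (s : 3.-tuple F) : Prop :=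
  uniq s.

Section CharacterVariety.
Variables (R : realType) (m n : nat).
Local Notation C := R[i].

(* SL(3, C)-representations of < x, y | x ^ n = y ^ m >. *)
Record rep := Rep {
  repA : 'M[C]_3;
  repB : 'M[C]_3;
  rep_detA : \det repA = 1;
  rep_detB : \det repB = 1;
  rep_rel : repA ^+ n = repB ^+ m
}.

Definition rep_conj (r s : rep) : Prop :=
  pair_conj (repA r) (repB r) (repA s) (repB s).

Definition rep_regular (f : rep -> C) : Prop :=
  exists p : {mpoly C[3 * 3 + 3 * 3]},
    forall r, f r = p.@[entries (repA r) (repB r)].

Definition rep_invariant (f : rep -> C) : Prop :=
  forall r s, rep_conj r s -> f r = f s.

Definition invariant_regular (f : rep -> C) : bool :=
  `[< rep_regular f /\ rep_invariant f >].

Lemma invariant_regularP (f : rep -> C) :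
  reflect (rep_regular f /\ rep_invariant f) (f \in invariant_regular).
Proof. exact: asboolP. Qed.

Fact invariant_regular_subring : subring_closed invariant_regular.
Proof.
split=> [|f g|f g].
- apply/invariant_regularP; split=> [|//]; exists 1 => r; by rewrite meval1.
- move=> /invariant_regularP[[p fp] fi] /invariant_regularP[[q gq] gi].
  apply/invariant_regularP; split=> [|r s rs].
    by exists (p - q) => r; rewrite mevalB -fp -gq.
  by rewrite /= -[LHS]/(f r - g r) -[RHS]/(f s - g s) (fi _ _ rs) (gi _ _ rs).
- move=> /invariant_regularP[[p fp] fi] /invariant_regularP[[q gq] gi].
  apply/invariant_regularP; split=> [|r s rs].
    by exists (p * q) => r; rewrite mevalM -fp -gq.
  by rewrite /= -[LHS]/(f r * g r) -[RHS]/(f s * g s) (fi _ _ rs) (gi _ _ rs).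
Qed.

Fact invariant_regular_submod : subsemimod_closed invariant_regular.
Proof.
split=> [|c f]; first split=> [|f g].
- apply/invariant_regularP; split=> [|//]; exists 0 => r; by rewrite meval0.
- move=> /invariant_regularP[[p fp] fi] /invariant_regularP[[q gq] gi].
  apply/invariant_regularP; split=> [|r s rs].
    by exists (p + q) => r; rewrite mevalD -fp -gq.
  by rewrite /= -[LHS]/(f r + g r) -[RHS]/(f s + g s) (fi _ _ rs) (gi _ _ rs).
- move=> /invariant_regularP[[p fp] fi].
  apply/invariant_regularP; split=> [|r s rs].
    by exists (c *: p) => r; rewrite mevalZ -fp.
  by rewrite /= -[LHS]/(c * f r) -[RHS]/(c * f s) (fi _ _ rs).
Qed.

(* The algebra C[Hom(Gamma, SL(3, C))]^SL(3, C) of conjugation-invariant regular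
   functions on the representation variety.  Conjugation by GL(3, C) and by
   SL(3, C) have the same orbits. *)
Record invariant_ring := InvariantRing {
  invfun :> rep -> C;
  invfunP : invfun \in invariant_regular
}.

HB.instance Definition _ := [isSub for invfun].
HB.instance Definition _ := [Choice of invariant_ring by <:].
HB.instance Definition _ :=
  GRing.SubChoice_isSubComPzRing.Build _ _ invariant_ring
    invariant_regular_subring.

Definition trivial_rep : rep :=
  @Rep 1%:M 1%:M (det1 C 3) (det1 C 3)
    (etrans (expr1n _ n) (esym (expr1n _ m))).

Fact invariant_ring_nonzero : 1 != 0 :> invariant_ring.
Proof.
apply/eqP => /(congr1 (fun f : invariant_ring => f trivial_rep)) /eqP.
by rewrite -[X in X == _]/(1 : C) -[X in _ == X]/(0 : C) oner_eq0.
Qed.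

HB.instance Definition _ :=
  GRing.PzSemiRing_isNonZero.Build invariant_ring invariant_ring_nonzero.

HB.instance Definition _ :=
  GRing.SubZmodule_isSubLmodule.Build _ _ _ invariant_ring
    invariant_regular_submod.

Fact invariant_ring_scaleAl (a : C) (f g : invariant_ring) :
  a *: (f * g) = a *: f * g.
Proof.
by apply/val_inj/funext => r; rewrite /= -[LHS]/(a * (f r * g r)) mulrA.
Qed.

HB.instance Definition _ :=
  GRing.Lmodule_isLalgebra.Build C invariant_ring invariant_ring_scaleAl.

(* The affine GIT quotient: the (closed) points of the spectrum of the algebra
   of invariants, i.e. the C-algebra morphisms from it to C. *)
Definition char_variety : Type := {lrmorphism invariant_ring -> C^o}.

Section Class.
Variable r : rep.
Definition rep_eval (f : invariant_ring) : C^o := f r.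
Fact rep_eval_is_linear : linear rep_eval.
Proof. by []. Qed.
Fact rep_eval_is_multiplicative : monoid_morphism rep_eval.
Proof. by []. Qed.
HB.instance Definition _ :=
  GRing.isLinear.Build C invariant_ring C^o _ rep_eval rep_eval_is_linear.
HB.instance Definition _ :=
  GRing.isMonoidMorphism.Build invariant_ring C^o rep_eval
    rep_eval_is_multiplicative.
(* The image of [r] under the quotient map. *)
Definition rep_class : char_variety := rep_eval.
End Class.

Definition zariski_closure (S : set char_variety) : set char_variety :=
  [set x | forall f : invariant_ring, (forall y, S y -> y f = 0) -> x f = 0].

(* [phi] restricts to an isomorphism of affine varieties from the closed subset
   [Z] to C^2: it is a bijection identifying the coordinate ring of [Z], which
   consists of the restrictions to [Z] of the elements of [invariant_ring],
   with the polynomial functions on C^2. *)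
Definition affine_plane_iso (Z : set char_variety)
    (phi : char_variety -> 'rV[C]_2) : Prop :=
  [/\ set_bij Z setT phi,
      forall p : {mpoly C[2]}, exists f : invariant_ring,
        forall x, Z x -> x f = p.@[phi x 0]
    & forall f : invariant_ring, exists p : {mpoly C[2]},
        forall x, Z x -> x f = p.@[phi x 0]].

Definition rep_irreducible (r : rep) : Prop :=
  pair_irreducible (repA r) (repB r).

Definition rep_partially_reducible (r : rep) : Prop :=
  exists (A2 B2 : 'M[C]_2) (a b : C), pair_irreducible A2 B2 /\
    pair_conj (repA r) (repB r)
      (block_mx A2 0 0 a%:M : 'M_(2 + 1)) (block_mx B2 0 0 b%:M : 'M_(2 + 1)).

Definition rep_totally_reducible (r : rep) : Prop :=
  exists d e : 'rV[C]_3,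
    pair_conj (repA r) (repB r) (diag_mx d) (diag_mx e).

Definition partially_reducible_points : set char_variety :=
  rep_class @` [set r | rep_partially_reducible r].

Definition totally_reducible_points : set char_variety :=
  rep_class @` [set r | rep_totally_reducible r].

Definition irreducible_points (alpha beta : 3.-tuple C) : set char_variety :=
  rep_class @` [set r | [/\ rep_irreducible r,
                           has_eigenvalues (repA r) alpha
                         & has_eigenvalues (repB r) beta]].

(* Nonemptiness excludes the choices of eigenvalues for which there is no
   irreducible representation, e.g. when they are not compatible with the
   relation A ^ n = B ^ m. *)
Definition two_dim_component (X : set char_variety) : Prop :=
  exists alpha beta : 3.-tuple C,
    [/\ one_double_eigenvalue alpha /\ three_distinct_eigenvalues beta \/
          three_distinct_eigenvalues alpha /\ one_double_eigenvalue beta,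
        X = irreducible_points alpha beta
      & X !=set0].

End CharacterVariety.

Section Lines.
Variable R : realType.
Local Notation C := R[i].

Definition plane_point (a b : C) : 'rV[C]_2 := \row_j (if j == 0 then a else b).

Definition line_x : set 'rV[C]_2 := [set z | z 0 0 = 0].
Definition line_y : set 'rV[C]_2 := [set z | z 0 1 = 0].
Definition line_xy : set 'rV[C]_2 := [set z | z 0 0 + z 0 1 = 1].

End Lines.

Arguments line_x {R}.
Arguments line_y {R}.
Arguments line_xy {R}.

(* Main.v *)
Require Import Defs.
From HB Require Import structures.
From mathcomp Require Import all_boot all_order all_algebra all_fingroup all_field.
From mathcomp Require Import boolp classical_sets functions reals.
From mathcomp.real_closed Require Import complex.
From mathcomp Require Import mpoly.
From mathcomp Require Import ring.

Set Implicit Arguments.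
Unset Strict Implicit.
Unset Printing Implicit Defensive.

Import GRing.Theory Num.Theory.
Local Open Scope ring_scope.
Local Open Scope classical_set_scope.

(** Suppose one generator has eigenvalues [a, a, b] and the other the distinct
    eigenvalues [e_0, e_1, e_2]; call their matrices [A] and [B]. On an irreducible
    representation the central element [x ^ n = y ^ m] acts by a scalar
    ([schur_scalar]), so [A] is diagonalizable, that is, [A = a + (b - a) v w]
    for a column [v] and a row [w] with [w v = 1]. In a basis where
    [B = diag (e_0, e_1, e_2)], the only freedom left is the rescaling of the basis
    vectors, so the class is determined by the numbers [t_i = v_i w_i], whose sum
    is [1]. They are the barycentric coordinates of a point of the plane, and the
    representation is irreducible exactly when none of them vanishes
    ([irreducible_locus_psi]).

    Conversely every [z] in the plane, with barycentric coordinates [t], gives a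
    representation [psi_rep z], with [v = (1, 1, 1)] and [w = t]. Its coordinates
    are recovered by invariants: if [P_i] is the Lagrange polynomial with
    [P_i (e_j) = delta_ij], then [P_i (B)] is the projector on the [i]-th
    eigenline of [B] and [tr (A P_i (B)) = a + (b - a) t_i]. These traces define
    [phi] on the whole character variety, with [phi (psi z) = z]. An invariant
    [f] restricts to a polynomial [p] along [psi]; thus [f - p (phi)] vanishes on
    the component, hence on its closure, and a point [x] of the closure satisfies
    [x = psi (phi x)]. As the irreducible locus is dense in the plane
    ([off_lines_dense]), the closure is the whole image of [psi] ([closure_psi]).

    The type of [psi z] is read off from
    [tr (A P_i (B) A P_j (B)) = (b - a) ^ 2 t_i t_j] for [i <> j]
    ([psi_entries]): on a partially or totally reducible representation these
    numbers tell which eigenlines of [B] are linked by [A]. The representation [psi_rep z] itself is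
    not semisimple when some [t_i] vanishes, but it degenerates to a semisimple
    one in the same class ([psi_degenerate]). So [psi z] is partially reducible
    when exactly one [t_i] vanishes and totally reducible when two do. *)

(** * Matrix pairs, conjugacy and irreducibility *)

Section Conjugacy.
Variables (F : fieldType) (k : nat).
Implicit Types A B P : 'M[F]_k.

Lemma pair_conj_trans A1 B1 A2 B2 A3 B3 :
  pair_conj A1 B1 A2 B2 -> pair_conj A2 B2 A3 B3 -> pair_conj A1 B1 A3 B3.
Proof.
move=> [P Pu [-> ->]] [Q Qu [-> ->]]; exists (Q *m P).
  by rewrite unitmx_mul Qu Pu.
have -> : invmx (Q *m P) = invmx P *m invmx Q.
  apply: (can_inj (mulKmx (_ : Q *m P \in unitmx))); first by rewrite unitmx_mul Qu.
  by rewrite mulmxV ?unitmx_mul ?Qu // mulmxA mulmxK // mulmxV.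
by rewrite !mulmxA.
Qed.

Lemma pair_conj_sym A B A' B' : pair_conj A B A' B' -> pair_conj A' B' A B.
Proof.
move=> [P Pu [-> ->]]; exists (invmx P); first by rewrite unitmx_inv.
by rewrite invmxK !mulmxA mulVmx // !mul1mx !mulmxKV.
Qed.

(** [P A = A' P] is the form of conjugacy that is linear in [P]. *)
Lemma pair_conj_intro P A B A' B' : P \in unitmx ->
  P *m A = A' *m P -> P *m B = B' *m P -> pair_conj A B A' B'.
Proof. by move=> Pu PA PB; exists P => //; rewrite PA PB !mulmxK. Qed.

Lemma pair_conj_comm A B A' B' : pair_conj A B A' B' ->
  comm_mx A B -> comm_mx A' B'.
Proof.
move=> [P Pu [-> ->]]; rewrite /comm_mx => AB.
have mulP M N : P *m M *m invmx P *m (P *m N *m invmx P) = P *m (M *m N) *m invmx P.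
  by rewrite !mulmxA mulmxKV.
by rewrite !mulP AB.
Qed.

Lemma pair_conj_char_poly A B A' B' : pair_conj A B A' B' ->
  char_poly A' = char_poly A /\ char_poly B' = char_poly B.
Proof.
move=> [P Pu [-> ->]].
suff char_poly_conj M : char_poly (P *m M *m invmx P) = char_poly M by [].
pose Q := map_mx polyC P.
have QV : Q *m map_mx polyC (invmx P) = 1%:M by rewrite -map_mxM mulmxV ?map_mx1.
have -> : char_poly (P *m M *m invmx P)
        = \det (Q *m char_poly_mx M *m map_mx polyC (invmx P)).
  congr (\det _); rewrite /char_poly_mx mulmxBr mulmxBl !map_mxM; congr (_ - _).
  by rewrite mul_mx_scalar -scalemxAl QV scalemx1.
by rewrite !det_mulmx mulrAC -det_mulmx QV det1 mul1r.
Qed.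

Lemma pair_conj_irreducible A B A' B' : pair_conj A B A' B' ->
  pair_irreducible A B -> pair_irreducible A' B'.
Proof.
move=> [P Pu [-> ->]] [k_gt0 irr]; split=> // V.
have stab M : stablemx V (P *m M *m invmx P) -> stablemx (V *m P) M.
  by move=> /(submxMr P); rewrite !mulmxA mulmxKV.
move=> /stab VA /stab VB; have := irr _ VA VB.
by rewrite -!mxrank_eq0 /row_full mxrankMfree // row_free_unit.
Qed.

Lemma pair_conj_perm (s : 'S_k) A B :
  pair_conj A B (\matrix_(i, j) A (s i) (s j)) (\matrix_(i, j) B (s i) (s j)).
Proof.
have perm_conj (M : 'M[F]_k) : perm_mx s *m M = (\matrix_(i, j) M (s i) (s j)) *m perm_mx s.
  rewrite -row_permE -[X in perm_mx X]invgK -col_permE.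
  by apply/matrixP => i j; rewrite !mxE permKV.
exact: (pair_conj_intro (unitmx_perm _ s) (perm_conj A) (perm_conj B)).
Qed.

End Conjugacy.

(** Over an algebraically closed field, a matrix commuting with an irreducible
    pair is scalar, as its eigenspaces are subrepresentations. *)
Lemma schur_scalar (F : closedFieldType) (k : nat) (A B M : 'M[F]_k) :
  pair_irreducible A B -> comm_mx M A -> comm_mx M B -> exists c, M = c%:M.
Proof.
move=> [k_gt0 irr] MA MB.
have /closed_rootP[c] : size (char_poly M) != 1%N.
  by rewrite size_char_poly; case: k k_gt0 {A B M irr MA MB}.
rewrite -eigenvalue_root_char => Mc; exists c.
have := irr _ (comm_mx_stable_eigenspace c MA) (comm_mx_stable_eigenspace c MB).
rewrite (negPf Mc) -sub1mx => /eigenspaceP.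
by rewrite mul1mx scalemx1.
Qed.

(** The coordinate subspace spanned by [S] is invariant under every diagonal
    matrix, so an irreducible [A] must lead out of it. *)
Lemma irreducible_diag_link (F : fieldType) (k : nat) (A : 'M[F]_k)
    (d : 'rV[F]_k) (S : pred 'I_k) (i j : 'I_k) :
  pair_irreducible A (diag_mx d) -> S i -> ~~ S j ->
  exists p q, [/\ S p, ~~ S q & A p q != 0].
Proof.
move=> [_ irr] Si Sj; apply: contrapT => noAS.
pose V := diag_mx (\row_l (S l)%:R) : 'M[F]_k.
have VA : stablemx V A.
  have -> : V *m A = V *m A *m V; last exact: submxMl.
  apply/matrixP => p q; rewrite mul_mx_diag mul_diag_mx !mxE.
  have [Sp|_] := boolP (S p); last by rewrite !mul0r.
  have [Sq|Sq] := boolP (S q); first by rewrite mulr1.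
  rewrite mulr0 mul1r; apply/eqP; rewrite -[_ == _]negbK.
  by apply/negP => Apq; apply: noAS; exists p, q.
have VD : stablemx V (diag_mx d).
  by apply: comm_mx_stable; rewrite /comm_mx diag_mxC.
case/orP: (irr V VA VD) => [/eqP/matrixP/(_ i i)/eqP|].
  by rewrite !mxE eqxx Si oner_eq0.
rewrite row_full_unit unitmxE det_diag (bigD1 j) //= !mxE (negPf Sj).
by rewrite mul0r unitr0.
Qed.

Definition lagrange (F : fieldType) (k : nat) (d : 'rV[F]_k) (i : 'I_k) :=
  \prod_(l | l != i) ((d 0 i - d 0 l)^-1 *: ('X - (d 0 l)%:P)).

(** These are the projectors on the coordinate axes. *)
Lemma horner_mx_lagrange (F : fieldType) (k : nat) (d : 'rV[F]_k.+1) i :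
  injective (d 0) -> horner_mx (diag_mx d) (lagrange d i) = delta_mx i i.
Proof.
move=> d_inj; rewrite horner_mx_diag; apply/matrixP => p q; rewrite !mxE.
have [<-|pq] := eqVneq p q; last first.
  rewrite mulr0n; have [ip|//] := eqVneq p i.
  by rewrite -ip [q == p]eq_sym (negPf pq).
rewrite mulr1n andbb horner_prod; have [->|pi] := eqVneq p i; last first.
  by rewrite (bigD1 p) //= !hornerE subrr mulr0 mul0r.
rewrite big1 // => l li; rewrite !hornerE mulVf // subr_eq0.
by apply: contra li => /eqP/d_inj->.
Qed.

(** Subspaces stable under a diagonal matrix with distinct entries are
    coordinate subspaces, and a matrix without zero off the diagonal preserves
    no proper one. *)
Lemma irreducible_diag (F : fieldType) (k : nat) (A : 'M[F]_k.+1)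
    (d : 'rV[F]_k.+1) :
  injective (d 0) -> (forall i j, i != j -> A i j != 0) ->
  pair_irreducible A (diag_mx d).
Proof.
move=> d_inj A_neq0; split=> // V VA VD; have [->|V0] := eqVneq V 0; first by [].
have proj (u : 'rV_k.+1) i :
    (u <= V)%MS -> u 0 i != 0 -> ((delta_mx 0 i : 'rV[F]_k.+1) <= V)%MS.
  move=> uV ui.
  have : (u *m horner_mx (diag_mx d) (lagrange d i) <= V)%MS.
    by apply: submx_trans (submxMr _ uV) _; exact: horner_mx_stable.
  have -> : u *m horner_mx (diag_mx d) (lagrange d i) = u 0 i *: delta_mx 0 i.
    rewrite horner_mx_lagrange //; apply/rowP => j; rewrite !mxE (bigD1 i) //=.
    by rewrite !mxE eqxx big1 ?addr0 // => l li; rewrite !mxE (negPf li) mulr0.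
  by rewrite eqmx_scale.
have [i Vi] : exists i, ((delta_mx 0 i : 'rV[F]_k.+1) <= V)%MS.
  have /rowV0Pn[u uV] := V0; move=> /rV0Pn[i ui].
  by exists i; apply: proj uV ui.
apply/orP; right; rewrite -sub1mx; apply/row_subP => j; rewrite row1.
have [->|ji] := eqVneq j i; first by [].
apply: (@proj (delta_mx 0 i *m A)); first exact: submx_trans (submxMr _ Vi) VA.
by rewrite -rowE mxE A_neq0 // eq_sym.
Qed.

(** Diagonalizability provides the eigenvalues in some order only; a permutation
    of the basis puts them in the order of [d]. *)
Lemma diagonalizable_spectrum (F : fieldType) (k : nat) (A : 'M[F]_k.+1)
    (d : 'rV[F]_k.+1) (rs : seq F) :
  uniq rs -> mxminpoly A %| \prod_(x <- rs) ('X - x%:P) ->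
  char_poly A = \prod_i ('X - (d 0 i)%:P) ->
  exists2 P, P \in unitmx & P *m A = diag_mx d *m P.
Proof.
move=> rs_uniq A_rs charA.
have [P Pu /diagonalizable_forPex[d' /(simmxP Pu) PA]] :
  diagonalizable A by apply/diagonalizableP; exists rs.
have AP := pair_conj_intro Pu PA PA.
have [s sd] : exists s : 'S_k.+1, forall i, d 0 i = d' 0 (s i).
  have : perm_eq [tuple d 0 i | i < k.+1] [tuple d' 0 i | i < k.+1].
    apply: prod_XsubC_eq; rewrite !big_tuple.
    under eq_bigr do rewrite tnth_mktuple.
    under [RHS]eq_bigr do rewrite tnth_mktuple.
    have [+ _] := pair_conj_char_poly AP.
    rewrite -charA char_poly_trig => [<-|]; last exact: diag_mx_is_trig.
    by apply: eq_bigr => i _; rewrite mxE eqxx.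
  move=> /tuple_permP[s /val_inj ds]; exists s => i.
  by move/(congr1 (fun t => tnth t i)): ds; rewrite !tnth_mktuple.
have [Q Qu [QA _]] := pair_conj_trans AP (pair_conj_perm s _ _).
exists Q => //; rewrite -[Q *m A](mulmxKV Qu) -QA; congr (_ *m _).
by apply/matrixP => i j; rewrite !mxE sd (inj_eq perm_inj).
Qed.

Lemma diagonalize_simple (F : fieldType) (k : nat) (B : 'M[F]_k.+1)
    (d : 'rV[F]_k.+1) :
  injective (d 0) -> char_poly B = \prod_i ('X - (d 0 i)%:P) ->
  exists2 P, P \in unitmx & P *m B = diag_mx d *m P.
Proof.
move=> d_inj charB; apply: (@diagonalizable_spectrum _ _ _ _ (codom (d 0))) => //.
  by rewrite map_inj_uniq ?enum_uniq.
by rewrite big_image /= -charB mxminpoly_dvd_char.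
Qed.

(** The polynomial ['X^N - c] kills [A] and has simple roots. *)
Lemma diagonalize_root_of_scalar (F : numClosedFieldType) (k N : nat)
    (A : 'M[F]_k.+1) (c : F) (d : 'rV[F]_k.+1) :
  (0 < N)%N -> c != 0 -> A ^+ N = c%:M ->
  char_poly A = \prod_i ('X - (d 0 i)%:P) ->
  exists2 P, P \in unitmx & P *m A = diag_mx d *m P.
Proof.
move=> N_gt0 c_neq0 AN; pose p : {poly F} := 'X^N - c%:P.
have p_monic : p \is monic by rewrite monicE lead_coefXnsubC.
have [rs] := closed_field_poly_normal p; rewrite (monicP p_monic) scale1r => p_rs.
apply: (@diagonalizable_spectrum _ _ _ _ rs).
  have dpE : N%:R^-1 *: 'X * p^`() = 'X^N.
    rewrite derivB derivC subr0 derivXn -scalerAl mulrnAr -exprS prednK //.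
    by rewrite -scaler_nat scalerA mulVf ?scale1r // pnatr_eq0 -lt0n.
  rewrite -separable_prod_XsubC -p_rs unlock; apply/Bezout_coprimepP.
  exists (- 1, N%:R^-1 *: 'X); rewrite /= dpE mulN1r opprB subrK.
  by rewrite polyC_eqp1.
rewrite -p_rs; apply: mxminpoly_min.
by rewrite rmorphB rmorphXn /= horner_mx_X horner_mx_C AN subrr.
Qed.

Lemma eigenvalue_scalar_power (F : fieldType) (k N : nat) (A : 'M[F]_k.+1) (c x : F) :
  A ^+ N = c%:M -> root (char_poly A) x -> x ^+ N = c.
Proof.
move=> AN; rewrite -eigenvalue_root_char => /eigenvalueP[u uA u0].
have uAN j : u *m A ^+ j = x ^+ j *: u.
  elim: j => [|j IHj]; first by rewrite !expr0 mulmx1 scale1r.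
  by rewrite exprSr -[A ^+ j * A]/(A ^+ j *m A) mulmxA IHj -scalemxAl uA scalerA -exprSr.
apply/eqP; rewrite -subr_eq0; have := uAN N; rewrite AN mul_mx_scalar => /eqP.
by rewrite -subr_eq0 -scalerBl scaler_eq0 (negPf u0) orbF -opprB oppr_eq0.
Qed.

Lemma det_spectrum (F : fieldType) (k : nat) (A : 'M[F]_k) (d : 'rV[F]_k) :
  char_poly A = \prod_i ('X - (d 0 i)%:P) -> \det A = \prod_i d 0 i.
Proof.
move=> charA; have := char_poly_det A; rewrite charA -horner_coef0 horner_prod.
under eq_bigr do rewrite hornerXsubC sub0r.
by rewrite prodrN card_ord => /(can_inj (signrMK k)).
Qed.

(** * Rank one perturbations of scalar matrices and traces of words *)

Section Model.
Variable S : comNzRingType.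
Implicit Types (a b : S) (v : 'cV[S]_3) (w : 'rV[S]_3).

(** When [w *m v = 1], row vectors are multiplied by [b] on the line of [w] and
    by [a] on the kernel of [v]. *)
Definition model_mx a b v w : 'M[S]_3 := a%:M + (b - a) *: (v *m w).

Lemma model_mxE a b v w i j :
  model_mx a b v w i j = a *+ (i == j) + (b - a) * (v i 0 * w 0 j).
Proof. by rewrite !mxE big_ord1. Qed.

Lemma model_mx_exp a b v w k : w *m v = 1%:M ->
  model_mx a b v w ^+ k = model_mx (a ^+ k) (b ^+ k) v w.
Proof.
move=> wv; have idem : v *m w *m (v *m w) = v *m w.
  by rewrite mulmxA -(mulmxA v) wv mulmx1.
elim: k => [|k IHk].
  by rewrite !expr0 /model_mx subrr scale0r addr0.
rewrite exprS IHk /model_mx -[LHS]/(_ *m _) mulmxDl !mulmxDr.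
rewrite -scalar_mxM -exprS -addrA; congr (_ + _).
rewrite mul_scalar_mx mul_mx_scalar -scalemxAl -scalemxAr idem !scalerA.
by rewrite -!scalerDl !exprS; congr (_ *: _); ring.
Qed.

(** The rank one case of Sylvester's determinant identity, in dimension 3. *)
Lemma det_rank1_update u c v w :
  \det (u%:M + c *: (v *m w)) = u ^+ 2 * (u + c * (w *m v) 0 0).
Proof.
pose x l := v (inord l) 0; pose y l := w 0 (inord l).
have entryE i j : (u%:M + c *: (v *m w)) i j = u *+ (i == j :> nat) + c * (x i * y j).
  by rewrite !mxE big_ord1 /x /y !inord_val.
have -> : (w *m v) 0 0 = \sum_(l < 3) y l * x l.
  by rewrite mxE; apply: eq_bigr => l _; rewrite /x /y !inord_val.
move: (u%:M + c *: _) entryE => M entryE.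
rewrite (expand_det_row _ 0) !big_ord_recl !big_ord0 /cofactor.
rewrite !(expand_det_row _ 0) !big_ord_recl !big_ord0 /cofactor !det_mx11 !mxE.
rewrite !entryE /= /bump /=.
ring.
Qed.

Lemma det_model_mx a b v w : w *m v = 1%:M -> \det (model_mx a b v w) = a ^+ 2 * b.
Proof. by move=> wv; rewrite det_rank1_update wv mxE eqxx mulr1n; ring. Qed.

End Model.

Lemma map_model_mx (S T : comNzRingType) (f : {rmorphism S -> T}) a b v w :
  map_mx f (model_mx a b v w) = model_mx (f a) (f b) (map_mx f v) (map_mx f w).
Proof. by rewrite map_mxD map_mxZ map_mxM map_scalar_mx rmorphB. Qed.

(** These functions of the pair are conjugation invariant; with Lagrange polynomials
    for [ps], they read off products of entries of [A] along cycles, in a basis of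
    eigenvectors of [B]. *)
Definition word_trace (S : comNzRingType) k (ps : seq {poly S})
    (A B : 'M[S]_k.+1) : S :=
  \tr (\prod_(p <- ps) (A *m horner_mx B p)).

Lemma map_word_trace (S T : comNzRingType) (f : {rmorphism S -> T}) k ps
    (A B : 'M[S]_k.+1) :
  f (word_trace ps A B)
    = word_trace (map (map_poly f) ps) (map_mx f A) (map_mx f B).
Proof.
rewrite /word_trace -trace_map_mx big_map; congr (\tr _).
by rewrite rmorph_prod; apply: eq_bigr => p _ /=; rewrite map_mxM map_horner_mx.
Qed.

Section ModelField.
Variable F : fieldType.
Implicit Types (a b : F) (v : 'cV[F]_3) (w d : 'rV[F]_3).

Lemma char_poly_model_mx a b v w : w *m v = 1%:M ->
  char_poly (model_mx a b v w) = ('X - a%:P) ^+ 2 * ('X - b%:P).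
Proof.
move=> wv; rewrite /char_poly.
have -> : char_poly_mx (model_mx a b v w) =
    ('X - a%:P)%:M + (a - b)%:P *: (map_mx polyC v *m map_mx polyC w).
  rewrite /char_poly_mx map_model_mx /model_mx opprD addrA raddfB /=.
  by rewrite -scaleNr opprB polyCB.
rewrite det_rank1_update -map_mxM wv map_mx1 mxE eqxx mulr1n.
by rewrite polyCB; ring.
Qed.

Lemma model_mx_conj a b v w P : P \in unitmx ->
  P *m model_mx a b v w = model_mx a b (P *m v) (w *m invmx P) *m P.
Proof.
move=> Pu; rewrite /model_mx mulmxDl mulmxDr scalar_mxC -scalemxAl -scalemxAr.
by rewrite !mulmxA mulmxKV.
Qed.

(** Conjugating by [diag u] rescales [v] and [w] inversely. *)
Lemma model_mx_rescale a b v w v' w' d (u : 'I_3 -> F) :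
  (forall i, u i != 0) -> (forall i, v' i 0 = u i * v i 0) ->
  (forall i, w 0 i = w' 0 i * u i) ->
  pair_conj (model_mx a b v w) (diag_mx d) (model_mx a b v' w') (diag_mx d).
Proof.
move=> u0 vE wE; pose P := diag_mx (\row_i u i) : 'M[F]_3.
apply: (@pair_conj_intro _ _ P).
- by rewrite unitmxE det_diag unitfE; apply/prodf_neq0 => i _; rewrite mxE.
- apply/matrixP => i j; rewrite mul_mx_diag mul_diag_mx !mxE !big_ord1 vE wE.
  by have [->|_] := eqVneq i j; rewrite ?mulr1n ?mulr0n; ring.
- by rewrite diag_mxC.
Qed.

(** The column [v] of [P^-1] and the row [w] of [P] are the eigenvectors of [A]
    for [b]. *)
Lemma model_mx_diag a b A P : P \in unitmx ->
  P *m A = diag_mx (\row_i (if i == ord_max then b else a)) *m P ->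
  exists v w, w *m v = 1%:M /\ A = model_mx a b v w.
Proof.
move=> Pu PA; exists (col ord_max (invmx P)), (row ord_max P); split.
  rewrite colE rowE mulmxA -(mulmxA _ P) mulmxV // mulmx1 mul_delta_mx.
  by apply/matrixP => i j; rewrite !ord1 !mxE.
rewrite -[A in LHS](mulKmx Pu) PA.
have -> : diag_mx (\row_i (if i == ord_max then b else a)) =
    a%:M + (b - a) *: delta_mx ord_max ord_max :> 'M[F]_3.
  apply/matrixP => i j; rewrite !mxE.
  have [<-|ij] := eqVneq i j; last first.
    have [im|_] := eqVneq i ord_max; last by rewrite mulr0 addr0.
    by rewrite -im [j == i]eq_sym (negPf ij) mulr0 addr0.
  rewrite andbb; have [_|_] := eqVneq i ord_max; rewrite ?mulr1n ?mulr1 ?mulr0.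
    by rewrite addrC subrK.
  by rewrite addr0.
rewrite mulmxDl mulmxDr mul_scalar_mx -scalemxAr mulVmx // scalemx1.
rewrite -scalemxAl -scalemxAr; congr (_ + _ *: _).
by rewrite colE rowE -(mul_delta_mx (0 : 'I_1)) -!mulmxA.
Qed.

Lemma word_trace_conj k ps (A B A' B' : 'M[F]_k.+1) : pair_conj A B A' B' ->
  word_trace ps A' B' = word_trace ps A B.
Proof.
move=> [P Pu [-> ->]]; rewrite /word_trace.
have -> : \prod_(p <- ps) (P *m A *m invmx P *m horner_mx (P *m B *m invmx P) p)
    = P *m (\prod_(p <- ps) (A *m horner_mx B p)) *m invmx P.
  elim: ps => [|p ps IHps]; first by rewrite !big_nil mulmx1 mulmxV.
  rewrite !big_cons IHps horner_mx_uconj // -![_ * _]/(_ *m _) !mulmxA.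
  by rewrite !mulmxKV.
by rewrite mxtrace_mulC mulmxA mulVmx // mul1mx.
Qed.

Section WordTraceDiag.
Variables (k : nat) (A : 'M[F]_k.+1) (d : 'rV[F]_k.+1).
Hypothesis d_inj : injective (d 0).

Let mxtrace_mul_delta (M : 'M[F]_k.+1) i : \tr (M *m delta_mx i i) = M i i.
Proof.
rewrite -(mul_delta_mx (0 : 'I_1)) mulmxA mxtrace_mulC mulmxA -rowE -colE.
by rewrite /mxtrace big_ord1 !mxE.
Qed.

Lemma word_trace_diag1 i : word_trace [:: lagrange d i] A (diag_mx d) = A i i.
Proof. by rewrite /word_trace big_seq1 horner_mx_lagrange // mxtrace_mul_delta. Qed.

Lemma word_trace_diag2 i j :
  word_trace [:: lagrange d i; lagrange d j] A (diag_mx d) = A i j * A j i.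
Proof.
rewrite /word_trace big_cons big_seq1 !horner_mx_lagrange // -[_ * _]/(_ *m _).
rewrite mulmxA mxtrace_mul_delta mxE (bigD1 i) //= big1 => [|l li].
  by rewrite addr0 mxE (bigD1 i) //= big1 => [|l li]; rewrite !mxE ?eqxx
    ?(negPf li) ?mulr0 // addr0 mulr1 mulrC.
by rewrite mxE big1 ?mul0r // => p _; rewrite !mxE (negPf li) andbF mulr0.
Qed.
End WordTraceDiag.

End ModelField.

(** * Invariants of representations *)

Lemma pair_conj_swap (F : fieldType) k (A B A' B' : 'M[F]_k) :
  pair_conj A B A' B' -> pair_conj B A B' A'.
Proof. by move=> [P Pu [AP BP]]; exists P. Qed.

Lemma pair_irreducible_swap (F : fieldType) k (A B : 'M[F]_k) :
  pair_irreducible A B -> pair_irreducible B A.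
Proof. by move=> [k_gt0 irr]; split=> // V VB VA; apply: irr. Qed.

Lemma rmorph_mmap (N : nat) (K S : comNzRingType) (inj : K -> S)
    (ev : {rmorphism S -> K}) (h : 'I_N -> S) (p : {mpoly K[N]}) :
  cancel inj ev -> ev (mmap inj h p) = p.@[ev \o h].
Proof.
move=> injK; rewrite /mmap rmorph_sum mevalE; apply: eq_bigr => x _.
rewrite rmorphM /= injK rmorph_prod; congr (_ * _).
by apply: eq_bigr => i _; rewrite rmorphXn.
Qed.

Section Representations.
Variables (R : realType) (m n : nat).
Local Notation C := R[i].
Local Notation rep := (rep R m n).
Local Notation invariant_ring := (invariant_ring R m n).
Implicit Types (r : rep) (s : bool).

(** The two generators play symmetric roles: for [s = true] the matrix with a
    double eigenvalue is [repA], for [s = false] it is [repB]. *)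
Definition dbl s r : 'M[C]_3 := if s then repA r else repB r.
Definition smp s r : 'M[C]_3 := if s then repB r else repA r.

Lemma dbl_smp_rel s r :
  dbl s r ^+ (if s then n else m) = smp s r ^+ (if s then m else n).
Proof. by case: s; rewrite /= rep_rel. Qed.

Lemma det_dbl s r : \det (dbl s r) = 1.
Proof. by case: s; rewrite /= ?rep_detA ?rep_detB. Qed.

Lemma det_smp s r : \det (smp s r) = 1.
Proof. by case: s; rewrite /= ?rep_detA ?rep_detB. Qed.

Lemma make_rep s (A B : 'M[C]_3) : \det A = 1 -> \det B = 1 ->
  A ^+ (if s then n else m) = B ^+ (if s then m else n) ->
  {r : rep | dbl s r = A & smp s r = B}.
Proof.
by case: s => dA dB AB;
  [exists (Rep dA dB AB) | exists (Rep dB dA (esym AB))].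
Qed.

Lemma rep_conjE s r r' : rep_conj r r' <->
  pair_conj (dbl s r) (smp s r) (dbl s r') (smp s r').
Proof. by case: s; split=> // /pair_conj_swap. Qed.

Lemma rep_irreducibleE s r :
  rep_irreducible r <-> pair_irreducible (dbl s r) (smp s r).
Proof. by case: s; split=> // /pair_irreducible_swap. Qed.

Lemma dbl_power_scalar s r : rep_irreducible r ->
  exists c, dbl s r ^+ (if s then n else m) = c%:M.
Proof.
move=> /(rep_irreducibleE s) irr.
have comm_exp (M : 'M[C]_3) N : comm_mx (M ^+ N) M.
  exact: (commr_sym (commrX N (commr_refl M))).
by apply: schur_scalar irr _ _; [|rewrite dbl_smp_rel]; apply: comm_exp.
Qed.

Lemma rep_partially_reducibleE s r : rep_partially_reducible r <->
  exists (A2 B2 : 'M[C]_2) (a b : C), pair_irreducible A2 B2 /\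
    pair_conj (dbl s r) (smp s r)
      (block_mx A2 0 0 a%:M : 'M_(2 + 1)) (block_mx B2 0 0 b%:M : 'M_(2 + 1)).
Proof.
case: s; split=> // -[A2 [B2 [a [b [irr AB]]]]]; exists B2, A2, b, a;
by split; [apply: pair_irreducible_swap | apply: pair_conj_swap].
Qed.

Lemma rep_totally_reducibleE s r : rep_totally_reducible r <->
  exists d e : 'rV[C]_3,
    pair_conj (dbl s r) (smp s r) (diag_mx d) (diag_mx e).
Proof. by case: s; split=> // -[d [e /pair_conj_swap de]]; exists e, d. Qed.

Lemma char_variety_ext (x y : char_variety R m n) : x =1 y -> x = y.
Proof.
case: x y => [x [[xa] [xm] [xs]]] [y [[ya] [ym] [ys]]] /= /funext xy.
case: _ / xy in ya ym ys *.
by rewrite (Prop_irrelevance xa ya) (Prop_irrelevance xm ym) (Prop_irrelevance xs ys).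
Qed.

Lemma rep_class_conj r r' : rep_conj r r' -> rep_class r = rep_class r'.
Proof.
move=> rr'; apply: char_variety_ext => f.
by have [_] := invariant_regularP _ (invfunP f); apply.
Qed.

(** Invariants are polynomial along families of representations whose matrices
    have entries in a [C]-algebra [S], with parameter values the retractions
    [ev : S -> C]. *)
Lemma invariant_family s (f : invariant_ring) (S : comNzRingType)
    (inj : C -> S) (MA MB : 'M[S]_3) :
  exists q : S, forall (ev : {rmorphism S -> C}) r, cancel inj ev ->
    dbl s r = map_mx ev MA -> smp s r = map_mx ev MB -> f r = ev q.
Proof.
have [[p fp] _] := invariant_regularP _ (invfunP f).
pose MA' := if s then MA else MB; pose MB' := if s then MB else MA.
exists (mmap inj (fun i => row_mx (mxvec MA') (mxvec MB') 0 i) p) => ev r injK rA rB.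
rewrite rmorph_mmap // fp; apply: meval_eq => i.
have [rAE rBE] : repA r = map_mx ev MA' /\ repB r = map_mx ev MB'.
  by rewrite /MA' /MB'; case: (s) rA rB.
rewrite /entries rAE rBE.
by rewrite -!map_mxvec -map_row_mx mxE.
Qed.

(** The coordinate functions on pairs of matrices, arranged in matrices: evaluating
    a construction on these shows that its result is a regular function. *)
Definition generic_mx (l : bool) : 'M[{mpoly C[3 * 3 + 3 * 3]}]_3 :=
  \matrix_(i, j) 'X_(if l then lshift (3 * 3) (mxvec_index i j)
                          else rshift (3 * 3) (mxvec_index i j)).

Lemma eval_generic_mx r (l : bool) :
  map_mx (meval (entries (repA r) (repB r))) (generic_mx l) = dbl l r.
Proof.
apply/matrixP => i j; rewrite !mxE mevalXU /entries.
by case: l; rewrite ?row_mxEl ?row_mxEr mxvecE.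
Qed.

Lemma word_trace_invariant s (ps : seq {poly C}) :
  exists f : invariant_ring, forall r, f r = word_trace ps (dbl s r) (smp s r).
Proof.
suff H : (fun r => word_trace ps (dbl s r) (smp s r)) \in @invariant_regular R m n.
  by exists (InvariantRing H).
apply/invariant_regularP; split=> [|r r' /(rep_conjE s) rr']; last first.
  by rewrite (word_trace_conj _ rr').
exists (word_trace (map (map_poly (@mpolyC _ _)) ps) (generic_mx s) (generic_mx (~~ s))).
move=> r; rewrite map_word_trace /= !eval_generic_mx -map_comp.
have -> : dbl (~~ s) r = smp s r by case: (s).
congr word_trace; rewrite -[LHS]map_id; apply: eq_map => p /=.
by apply/polyP => i; rewrite !coef_map_id0 ?mevalC ?meval0 ?mpolyC0.
Qed.

Lemma char_poly_invariant s (k : nat) :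
  exists f : invariant_ring, forall r, f r = (char_poly (smp s r))`_k.
Proof.
suff H : (fun r => (char_poly (smp s r))`_k) \in @invariant_regular R m n.
  by exists (InvariantRing H).
apply/invariant_regularP; split=> [|r r' /(rep_conjE s) rr']; last first.
  by rewrite (pair_conj_char_poly rr').2.
exists (char_poly (generic_mx (~~ s)))`_k => r.
rewrite -(coef_map (meval (entries (repA r) (repB r)))) map_char_poly.
by rewrite eval_generic_mx; case: (s).
Qed.

Lemma rep_class_word_trace s ps r r' : rep_class r = rep_class r' ->
  word_trace ps (dbl s r) (smp s r) = word_trace ps (dbl s r') (smp s r').
Proof.
have [f fE] := word_trace_invariant s ps.
by move=> /(congr1 (fun x : char_variety R m n => x f)) /=; rewrite /rep_eval !fE.
Qed.

Lemma rep_class_char_poly s r r' : rep_class r = rep_class r' ->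
  char_poly (smp s r) = char_poly (smp s r').
Proof.
move=> rr'; apply/polyP => k; have [f fE] := char_poly_invariant s k.
by move/(congr1 (fun x : char_variety R m n => x f)): rr'; rewrite /= /rep_eval !fE.
Qed.

End Representations.

(** * The plane of representations containing a component *)

(** The product [p * g] vanishes at every natural number. *)
Lemma poly_eq0_generic (F : numFieldType) (p g : {poly F}) :
  g != 0 -> (forall u, g.[u] != 0 -> p.[u] = 0) -> p = 0.
Proof.
move=> g0 pg; suff : p * g = 0 by move/eqP; rewrite mulf_eq0 (negPf g0) orbF => /eqP.
apply: contrapT => /eqP pg0; pose rs : seq F := [seq i%:R | i <- iota 0 (size (p * g))].
have := max_poly_roots pg0 (_ : all (root (p * g)) rs) (_ : uniq rs).
rewrite size_map size_iota ltnn => H; suff : false by []; apply: H.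
  apply/allP => u _; rewrite rootE hornerM.
  by have [->|/pg->] := eqVneq g.[u] 0; rewrite ?mulr0 ?mul0r.
by rewrite map_inj_uniq ?iota_uniq // => i j /eqP; rewrite eqr_nat => /eqP.
Qed.

(** Barycentric coordinates of the plane with respect to the triangle cut out by
    the lines [x = 0], [y = 0] and [x + y = 1]. *)
Definition bary (S : comNzRingType) (x y : S) : 'rV[S]_3 :=
  \row_i [:: x; y; 1 - x - y]`_i.

Lemma map_bary (S T : comNzRingType) (f : {rmorphism S -> T}) x y :
  map_mx f (bary x y) = bary (f x) (f y).
Proof.
apply/rowP => i; rewrite !mxE.
by case: i => -[|[|[|]]] //= _; rewrite !rmorphB rmorph1.
Qed.

Lemma bary_sum (S : comNzRingType) (x y : S) :
  bary x y *m (const_mx 1 : 'cV_3) = 1%:M.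
Proof.
apply/matrixP => i j; rewrite !ord1 !mxE !big_ord_recl big_ord0 !mxE /=.
by rewrite mulr1n; ring.
Qed.

Lemma bary_of_sum1 (S : comNzRingType) (w : 'rV[S]_3) :
  w *m (const_mx 1 : 'cV_3) = 1%:M -> w = bary (w 0 0) (w 0 1).
Proof.
move/matrixP/(_ 0 0); rewrite !mxE !big_ord_recl big_ord0 !mxE /= => w1.
apply/rowP => i; rewrite mxE; case: i => -[|[|[|]]] //= ilt.
- by congr (w _ _); apply: val_inj.
- by congr (w _ _); apply: val_inj.
have -> : Ordinal ilt = lift ord0 (lift ord0 ord0) by apply: val_inj.
have -> : 1 = lift ord0 ord0 :> 'I_3 by apply: val_inj.
by move: w1; rewrite mulr1n => <-; rewrite -[0]/ord0; ring.
Qed.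

(** The transposition [t] moves to the last place the index of the eigenvalue [x]
    of the one-dimensional block. *)
Lemma char_poly_block_split (F : fieldType) (d : 'rV[F]_(2 + 1)) (B : 'M[F]_2) x :
  char_poly (block_mx B 0 0 x%:M : 'M_(2 + 1)) = \prod_i ('X - (d 0 i)%:P) ->
  exists i, let t := tperm i (rshift 2 ord0) in d 0 i = x /\
    char_poly B = \prod_(k < 2) ('X - (d 0 (t (lshift 1 k)))%:P).
Proof.
have -> : char_poly (block_mx B 0 0 x%:M : 'M_(2 + 1)) = char_poly B * ('X - x%:P).
  rewrite /char_poly char_block_diag_mx det_ublock; congr (_ * _).
  by rewrite det_mx11 !mxE eqxx !mulr1n.
move=> charB; have : root (\prod_i ('X - (d 0 i)%:P)) x.
  by rewrite -charB rootM root_XsubC eqxx orbT.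
rewrite rootE horner_prod prodf_seq_eq0 => /hasP[i _ /=].
rewrite !hornerE subr_eq0 => /eqP xi; exists i; set t := tperm _ _; split=> //.
have X0 : 'X - x%:P != 0 by rewrite polyXsubC_eq0.
apply: (mulIf X0); rewrite charB (reindex_inj (@perm_inj _ t)) big_split_ord /=.
by rewrite big_ord1 /t tpermR xi.
Qed.

Section Parametrization.
Variables (R : realType) (m n : nat) (s : bool).
Local Notation C := R[i].
Local Notation rep := (rep R m n).
Local Notation invariant_ring := (invariant_ring R m n).
Local Notation char_variety := (char_variety R m n).
Variables (a b c : C) (e : 'rV[C]_3).
Hypotheses (ab : a != b) (e_inj : injective (e 0)).
Hypotheses (det_ab : a ^+ 2 * b = 1) (det_e : \prod_i e 0 i = 1).
Hypotheses (a_root : a ^+ (if s then n else m) = c)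
           (b_root : b ^+ (if s then n else m) = c)
           (e_root : forall i, e 0 i ^+ (if s then m else n) = c).
Implicit Types (r : rep) (z : 'rV[C]_2) (f : invariant_ring).

Let ba : b - a != 0. Proof. by rewrite subr_eq0 eq_sym. Qed.

Lemma model_rep (v : 'cV[C]_3) (w : 'rV[C]_3) : w *m v = 1%:M ->
  {r : rep | dbl s r = model_mx a b v w & smp s r = diag_mx e}.
Proof.
move=> wv; apply: make_rep; first by rewrite det_model_mx.
  by rewrite det_diag.
rewrite model_mx_exp // a_root b_root /model_mx subrr scale0r addr0.
have -> : diag_mx e = horner_mx (diag_mx e) 'X by rewrite horner_mx_X.
rewrite -rmorphXn /= horner_mx_diag; apply/matrixP => i j.
by rewrite !mxE hornerXn e_root.
Qed.

Definition coords z : 'rV[C]_3 := bary (z 0 0) (z 0 1).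

Definition psi_rep z : rep := s2val (model_rep (bary_sum (z 0 0) (z 0 1))).
Definition psi z : char_variety := rep_class (psi_rep z).

Lemma dbl_psi z : dbl s (psi_rep z) = model_mx a b (const_mx 1) (coords z).
Proof. by rewrite /psi_rep; case: model_rep. Qed.

Lemma smp_psi z : smp s (psi_rep z) = diag_mx e.
Proof. by rewrite /psi_rep; case: model_rep. Qed.

(** The matrices of [psi_rep z] are obtained by evaluation from matrices over
    [{mpoly C[2]}]. *)
Lemma psi_polynomial f : exists p : {mpoly C[2]}, forall z, psi z f = p.@[z 0].
Proof.
have [q qE] := @invariant_family R m n s f {mpoly C[2]} (@mpolyC _ _)
  (model_mx a%:MP b%:MP (const_mx 1) (bary 'X_0 'X_1))
  (map_mx (@mpolyC _ _) (diag_mx e)).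
exists q => z; apply: qE => [x||]; first by rewrite /= mevalC.
  rewrite dbl_psi map_model_mx map_bary /= !mevalC !mevalXU.
  by rewrite map_const_mx rmorph1.
rewrite smp_psi; apply/matrixP => i j; rewrite !mxE /=.
by rewrite mevalC.
Qed.

(** The [i]-th diagonal entry of [dbl s (psi_rep z)] is [a + (b - a) t_i], where
    [t] is [coords z]. *)
Lemma coord_invariant i : exists f, forall z, psi z f = coords z 0 i.
Proof.
have [f fE] := @word_trace_invariant R m n s [:: lagrange e i].
exists ((b - a)^-1 *: (f - a *: 1)) => z.
rewrite -[LHS]/((b - a)^-1 * (f (psi_rep z) - a * 1)) fE smp_psi.
rewrite word_trace_diag1 // dbl_psi model_mxE eqxx mulr1n mxE mul1r mulr1.
by rewrite [a + _]addrC addrK mulKf.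
Qed.

Definition coord_fun (j : 'I_2) : invariant_ring :=
  sval (cid (coord_invariant (inord j))).

Definition phi (x : char_variety) : 'rV[C]_2 := \row_j x (coord_fun j).

Lemma psiK : cancel psi phi.
Proof.
move=> z; apply/rowP => j; rewrite mxE /coord_fun; case: cid => f /= ->.
rewrite mxE inordK; last by case: j => -[|[|]].
by case: j => -[|[|]] //= jlt; congr (z _ _); apply: val_inj.
Qed.

Lemma phi_pullback (p : {mpoly C[2]}) :
  exists f, forall x : char_variety, x f = p.@[phi x 0].
Proof.
exists (mmap (in_alg invariant_ring) coord_fun p) => x.
rewrite (@rmorph_mmap _ C _ _ x); last first.
  by move=> k; rewrite /= linearZ rmorph1 /= -[LHS]/(k * 1) mulr1.
by apply: meval_eq => j; rewrite mxE.
Qed.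

Definition off_lines : set 'rV[C]_2 := [set z | forall i, coords z 0 i != 0].

(** Join [z] to the barycentre of the triangle: along this line, the product of
    the three barycentric coordinates is a nonzero polynomial. *)
Lemma off_lines_dense f : (forall z, off_lines z -> psi z f = 0) -> forall z, psi z f = 0.
Proof.
move=> f0 z; pose line (x : C) : {poly C} := x%:P + 'X * (3%:R^-1 - x)%:P.
have lineE x u : (line x).[u] = x + u * (3%:R^-1 - x) by rewrite !hornerE.
have [q qE] := @invariant_family R m n s f {poly C} polyC
  (model_mx a%:P b%:P (const_mx 1) (bary (line (z 0 0)) (line (z 0 1))))
  (map_mx polyC (diag_mx e)).
pose zu u := plane_point (line (z 0 0)).[u] (line (z 0 1)).[u].
have coords_zu u : coords (zu u) =
      map_mx (horner_eval u) (bary (line (z 0 0)) (line (z 0 1))).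
  by rewrite map_bary /coords !mxE.
have {}qE u : psi (zu u) f = q.[u].
  apply: (qE (horner_eval u : {rmorphism {poly C} -> C})) => [x||].
  - by rewrite /= /horner_eval hornerC.
  - rewrite dbl_psi map_model_mx coords_zu map_const_mx rmorph1 /=.
    by rewrite /horner_eval !hornerC.
  - rewrite smp_psi; apply/matrixP => i j; rewrite !mxE /=.
    by rewrite /horner_eval hornerC.
pose g := \prod_i bary (line (z 0 0)) (line (z 0 1)) 0 i.
have gE u : g.[u] = \prod_i coords (zu u) 0 i.
  by rewrite /g horner_prod coords_zu; apply: eq_bigr => i _; rewrite [in RHS]mxE.
have q0 : q = 0.
  apply: (@poly_eq0_generic _ _ g) => [|u].
    apply: contraNneq (oner_neq0 C) => g0; have := gE 1.
    rewrite g0 horner0 => /esym/eqP; rewrite prodf_seq_eq0 => /hasP[i _ /=].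
    rewrite mxE !mxE !lineE !mul1r !(addrC _ (_ - _)) !subrK.
    case: i => -[|[|[|]]] //= _; rewrite ?invr_eq0 ?pnatr_eq0 //.
    have -> : 1 - 3%:R^-1 - 3%:R^-1 = 3%:R^-1 :> C by field.
    by rewrite invr_eq0 pnatr_eq0.
  rewrite gE -qE => /prodf_neq0 zu_good; apply: f0 => i; exact: zu_good.
have -> : z = zu 0.
  apply/rowP => j; rewrite mxE !lineE !mul0r !addr0.
  by case: j => -[|[|]] //= jlt; congr (z _ _); apply: val_inj.
by rewrite qE q0 horner0.
Qed.

(** If [f] restricts to the polynomial [p] along [psi], then [f] and the pullback
    of [p] by [phi] agree on the image of [psi], hence at every point [x] of the
    closure; this says that [x] and [psi (phi x)] agree on [f]. *)
Lemma closure_psi : zariski_closure (psi @` off_lines) = range psi.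
Proof.
apply/seteqP; split=> [x xX|_ [z _ <-] f fX]; last first.
  by apply: off_lines_dense => z' z'good; apply: fX; exists z'.
exists (phi x) => //; apply: char_variety_ext => f.
have [p pE] := psi_polynomial f; have [f' f'E] := phi_pullback p.
apply/esym/eqP; rewrite pE -f'E -subr_eq0 -rmorphB; apply/eqP/xX.
by move=> _ [z _ <-]; rewrite rmorphB /= pE f'E psiK subrr.
Qed.

Lemma psi_plane_iso : affine_plane_iso (range psi) phi.
Proof.
split=> [|p|f].
- split=> // [_ _ /set_mem[z _ <-] /set_mem[z' _ <-]|z _].
    move=> zz; exact: (congr1 psi (etrans (esym (psiK z)) (etrans zz (psiK z')))).
  by exists (psi z); rewrite ?psiK //; exists z.
- by have [f fE] := phi_pullback p; exists f.
- have [p pE] := psi_polynomial f; exists p => _ [z _ <-].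
  by rewrite pE psiK.
Qed.


Lemma coords_sum z : coords z *m (const_mx 1 : 'cV_3) = 1%:M.
Proof. exact: bary_sum. Qed.

Lemma char_poly_diag_e : char_poly (diag_mx e) = \prod_i ('X - (e 0 i)%:P).
Proof.
rewrite char_poly_trig; last exact: diag_mx_is_trig.
by apply: eq_bigr => i _; rewrite mxE eqxx.
Qed.

(** Both sides are the trace of [A P_i (B) A P_j (B)], with [P_i] and [P_j] the
    Lagrange polynomials at the eigenvalues of [B]: on the left for a representation
    in the class, on the right for [psi_rep z]. *)
Lemma psi_entries r z A i j : rep_class r = psi z ->
  pair_conj (dbl s r) (smp s r) A (diag_mx e) -> i != j ->
  A i j * A j i = (b - a) ^+ 2 * (coords z 0 i * coords z 0 j).
Proof.
move=> rz rA ij; rewrite -(word_trace_diag2 A e_inj) (word_trace_conj _ rA).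
rewrite (rep_class_word_trace s _ rz) smp_psi word_trace_diag2 // dbl_psi.
rewrite !model_mxE (negPf ij) [j == i]eq_sym (negPf ij) !mulr0n !mxE; ring.
Qed.

(** Replacing the entries of [v] facing zeros of [w] by a parameter [u] gives
    conjugate representations for all [u != 0]; their limit at [u = 0] has the
    same class, and is semisimple. *)
Lemma psi_degenerate z : exists r, [/\ psi z = rep_class r,
  dbl s r = model_mx a b (\col_i (coords z 0 i != 0)%:R) (coords z)
  & smp s r = diag_mx e].
Proof.
pose v (S : comNzRingType) (x : S) : 'cV[S]_3 :=
  \col_i (if coords z 0 i == 0 then x else 1).
have wv u : coords z *m v C u = 1%:M.
  rewrite -(coords_sum z); apply/matrixP => i j; rewrite !ord1 [LHS]mxE [RHS]mxE.
  apply: eq_bigr => k _; rewrite [v _ _ _ _]mxE [const_mx _ _ _]mxE.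
  by case: eqVneq => [->|//]; rewrite !mul0r.
have map_v (S T : comNzRingType) (g : {rmorphism S -> T}) x :
    map_mx g (v S x) = v T (g x).
  by apply/colP => i; rewrite !mxE; case: ifP; rewrite ?rmorph1.
have [r0 r0d r0s] := model_rep (wv 0).
exists r0; split; [ | | exact: r0s]; last first.
  rewrite r0d; congr model_mx; apply/colP => i; rewrite [LHS]mxE [RHS]mxE.
  by case: eqVneq.
apply: char_variety_ext => f.
have [q qE] := @invariant_family R m n s f {poly C} polyC
  (model_mx a%:P b%:P (v _ 'X) (map_mx polyC (coords z)))
  (map_mx polyC (diag_mx e)).
have {}qE u r : dbl s r = model_mx a b (v C u) (coords z) ->
    smp s r = diag_mx e -> f r = q.[u].
  move=> rd rs; apply: (qE (horner_eval u : {rmorphism {poly C} -> C})) => [x||].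
  - by rewrite /= /horner_eval hornerC.
  - rewrite rd map_model_mx map_v /= /horner_eval !hornerC hornerX.
    by congr model_mx; apply/rowP => i; rewrite !mxE hornerC.
  - by rewrite rs; apply/matrixP => i j; rewrite !mxE /= /horner_eval hornerC.
have q_const : q - (psi z f)%:P = 0.
  apply: (@poly_eq0_generic _ _ 'X) => [|u]; first by rewrite polyX_eq0.
  rewrite hornerX => u0; have [r rd rs] := model_rep (wv u).
  rewrite hornerD hornerN hornerC -(qE _ _ rd rs); apply/eqP; rewrite subr_eq0.
  suff -> : psi z = rep_class r by [].
  apply/rep_class_conj/(rep_conjE s); rewrite dbl_psi smp_psi rd rs.
  apply: (model_mx_rescale _ _ _ (u := fun i => v C u i 0)) => i.
  - by rewrite mxE; case: ifP => _; rewrite ?oner_neq0.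
  - by rewrite !mxE mulr1.
  - by rewrite [v _ _ _ _]mxE; case: eqVneq => [->|_]; rewrite ?mul0r ?mulr1.
rewrite [RHS](qE _ _ r0d r0s); move/eqP: q_const; rewrite subr_eq0 => /eqP->.
by rewrite hornerC.
Qed.

(** In a totally reducible representation the two generators commute, so one is
    diagonal in a basis of eigenvectors of the other and all the products of
    [psi_entries] vanish. Conversely, if they vanish the degeneration of [psi_rep z]
    is diagonal. *)
Lemma psi_totally_reducible z :
  totally_reducible_points (psi z) <->
  forall i j, i != j -> coords z 0 i * coords z 0 j = 0.
Proof.
split=> [[r /(rep_totally_reducibleE s)[d [d' rdd']] rz] i j ij|tt].
  have comm_r : comm_mx (dbl s r) (smp s r).
    by apply: (pair_conj_comm (pair_conj_sym rdd')); rewrite /comm_mx diag_mxC.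
  have char_smp : char_poly (smp s r) = \prod_i ('X - (e 0 i)%:P).
    by rewrite (rep_class_char_poly s rz) smp_psi char_poly_diag_e.
  have [P Pu Pr] := diagonalize_simple e_inj char_smp.
  pose A := P *m dbl s r *m invmx P.
  have rA : pair_conj (dbl s r) (smp s r) A (diag_mx e).
    by apply: (pair_conj_intro Pu) => //; rewrite mulmxKV.
  have comm_A : A *m diag_mx e = diag_mx e *m A := pair_conj_comm rA comm_r.
  clearbody A.
  have Aij : A i j = 0.
    have /eqP : (A *m diag_mx e) i j = (diag_mx e *m A) i j by rewrite comm_A.
    rewrite mul_mx_diag mul_diag_mx !mxE mulrC -subr_eq0 -mulrBl mulf_eq0.
    by rewrite subr_eq0 (inj_eq e_inj) eq_sym (negPf ij) => /eqP.
  have /eqP := psi_entries rz rA ij.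
  by rewrite Aij mul0r eq_sym mulf_eq0 expf_eq0 (negPf ba) /= => /eqP.
have [r [-> rd rs]] := psi_degenerate z; exists r => //.
apply/(rep_totally_reducibleE s); exists (\row_i dbl s r i i), e.
rewrite rs; have {1}-> : dbl s r = diag_mx (\row_i dbl s r i i).
  apply/matrixP => i j; rewrite mxE mxE; have [->//|ij] := eqVneq i j.
  rewrite mulr0n rd model_mxE (negPf ij) add0r mxE.
  have [i0|i0] := eqVneq (coords z 0 i) 0; first by rewrite mul0r mulr0.
  by have /eqP := tt i j ij; rewrite mulf_eq0 (negPf i0) => /eqP->; rewrite !mulr0.
by exists 1%:M; rewrite ?unitmx1 // invmx1 !mul1mx !mulmx1.
Qed.


(** In a sum of a line and an irreducible plane, diagonalize [smp s r] on each summand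
    and let [i] be the index of its eigenvalue on the line. Then [dbl s r] links the
    two other eigenlines in both directions, by irreducibility, and does not link
    them to the line, so that [psi_entries] tells which coordinates vanish.
    Conversely, the degeneration of [psi_rep z] splits off its [i]-th coordinate
    axis. *)
Lemma psi_partially_reducible z :
  partially_reducible_points (psi z) <->
  exists i, coords z 0 i = 0 /\ forall j, j != i -> coords z 0 j != 0.
Proof.
pose last := rshift 2 (ord0 : 'I_1).
(* [lshift] and [rshift] land in ['I_(2 + 1)], which is only convertible to the
   type ['I_3] of the indices of [coords z]. *)
have eqll (j k : 'I_2) : (lshift 1 j == lshift 1 k :> 'I_3) = (j == k) :=
  @eq_lshift 2 1 j k.
have eqlr (j : 'I_2) (k : 'I_1) : (lshift 1 j == rshift 2 k :> 'I_3) = false :=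
  @eq_lrshift 2 1 j k.
have eqrl (j : 'I_1) (k : 'I_2) : (rshift 2 j == lshift 1 k :> 'I_3) = false :=
  @eq_rlshift 2 1 j k.
split=> [[r /(rep_partially_reducibleE s)[A2 [B2 [a' [b' [irr rAB]]]]] rz]|].
  have charB : char_poly (block_mx B2 0 0 b'%:M : 'M_(2 + 1))
      = \prod_i ('X - (e 0 i)%:P).
    rewrite (pair_conj_char_poly rAB).2 (rep_class_char_poly s rz).
    by rewrite smp_psi char_poly_diag_e.
  have [i [b'E charB2]] := char_poly_block_split charB.
  pose t : 'S_(2 + 1) := tperm i last; exists i.
  have tK : involutive t by move=> j; rewrite tpermK.
  pose d2 := \row_(k < 2) e 0 (t (lshift 1 k)).
  have d2_inj : injective (d2 0).
    by move=> k l; rewrite !mxE => /e_inj/perm_inj; apply: (@lshift_inj 2 1).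
  have [P Pu PB] : exists2 P, P \in unitmx & P *m B2 = diag_mx d2 *m P.
    apply: diagonalize_simple => //; rewrite charB2.
    by apply: eq_bigr => k _; rewrite mxE.
  pose A2' := P *m A2 *m invmx P.
  have PA : P *m A2 = A2' *m P by rewrite mulmxKV.
  have irr2 := pair_conj_irreducible (pair_conj_intro Pu PA PB) irr.
  pose M : 'M_(2 + 1) := block_mx A2' 0 0 a'%:M.
  have rM : pair_conj (dbl s r) (smp s r) (\matrix_(j, k) M (t j) (t k)) (diag_mx e).
    have -> : diag_mx e = \matrix_(j, k)
        (block_mx (diag_mx d2) 0 0 b'%:M : 'M_(2 + 1)) (t j) (t k).
      apply/matrixP => j k; rewrite -[j]tK -[k]tK; move: (t j) (t k) => {}j {}k.
      rewrite [LHS]mxE [RHS]mxE !tK (inj_eq perm_inj).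
      case: (split_ordP j) => j' ->; case: (split_ordP k) => k' ->.
      - by rewrite block_mxEul !mxE eqll.
      - by rewrite block_mxEur mxE eqlr.
      - by rewrite block_mxEdl mxE eqrl.
      - by rewrite block_mxEdr !ord1 !mxE eqxx tpermR b'E.
    apply: pair_conj_trans rAB (pair_conj_trans _ (pair_conj_perm t _ _)).
    apply: (@pair_conj_intro _ _ (block_mx P 0 0 1%:M)).
    - by rewrite unitmxE det_ublock det1 mulr1 -unitmxE.
    - by rewrite !mulmx_block !(mulmx0, mul0mx, mul1mx, mulmx1, addr0, add0r) PA.
    - by rewrite !mulmx_block !(mulmx0, mul0mx, mul1mx, mulmx1, addr0, add0r) PB.
  have entryM k l : k != l -> M k l * M l k
      = (b - a) ^+ 2 * (coords z 0 (t k) * coords z 0 (t l)).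
    move=> kl; rewrite -(psi_entries rz rM) ?(inj_eq perm_inj) //.
    by rewrite [X in _ = X * _]mxE [X in _ = _ * X]mxE !tK.
  have ba2 : (b - a) ^+ 2 != 0 by rewrite expf_eq0 (negPf ba).
  have t_last : t last = i by rewrite tpermR.
  have prod0 k : coords z 0 (t (lshift 1 k)) * coords z 0 i = 0.
    apply: (mulfI ba2); rewrite -t_last -entryM ?eqlr //.
    by rewrite block_mxEur mxE mul0r mulr0.
  have ord2 (k l q : 'I_2) : k != l -> q != k -> q = l.
    move=> kl qk; apply/val_inj; move: kl qk; rewrite -!val_eqE.
    case: k l q => -[|[|]] // ? [[|[|]] // ?] [[|[|]] // ?].
  have link (k l : 'I_2) : k != l -> A2' k l != 0.
    move=> kl; have lk : ~~ pred1 k l by rewrite /= eq_sym.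
    have [p [q [/eqP-> qk Akq]]] := irreducible_diag_link irr2 (eqxx k : pred1 k k) lk.
    by rewrite -(ord2 _ _ _ kl qk).
  have nz k : coords z 0 (t (lshift 1 k)) != 0.
    have kl : k != rev_ord k by rewrite -val_eqE; case: (k) => -[|[|]].
    move: (rev_ord k) kl => l kl.
    have := entryM (lshift 1 k) (lshift 1 l); rewrite eqll.
    move=> /(_ kl); rewrite !block_mxEul; apply: contra_eq_neq => ->.
    by rewrite mul0r mulr0 mulf_neq0 // link // eq_sym.
  split=> [|j ji].
    by have /eqP := prod0 0; rewrite mulf_eq0 (negPf (nz 0)) => /eqP.
  have : t j != last by rewrite -[last]tK (inj_eq perm_inj) t_last.
  rewrite -{2}[j]tK; case: (split_ordP (t j)) => k ->; first by rewrite nz.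
  by rewrite !ord1 eqxx.
move=> [i [ci cj]]; have [r [-> rd rs]] := psi_degenerate z; exists r => //.
apply/(rep_partially_reducibleE s).
pose t : 'S_(2 + 1) := tperm i last.
have t_last : t last = i by rewrite tpermR.
pose M : 'M_(2 + 1) := \matrix_(j, k) dbl s r (t j) (t k).
pose N : 'M_(2 + 1) := \matrix_(j, k) smp s r (t j) (t k).
exists (ulsubmx M), (ulsubmx N), (drsubmx M 0 0), (drsubmx N 0 0).
have t_l k : t (lshift 1 k) != i.
  by rewrite -t_last (inj_eq perm_inj) eqlr.
split; last first.
  rewrite -!mx11_scalar.
  have -> : block_mx (ulsubmx M) 0 0 (drsubmx M) = M.
    rewrite -[RHS]submxK; congr block_mx; apply/matrixP => j k.
      rewrite !mxE rd model_mxE [(\col__ _) _ _]mxE !ord1 t_last.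
      by rewrite (negPf (t_l _)) ci mulr0 mulr0 addr0.
    rewrite !mxE rd model_mxE [(\col__ _) _ _]mxE !ord1 t_last.
    by rewrite eq_sym (negPf (t_l _)) ci eqxx mul0r mulr0 addr0.
  have -> : block_mx (ulsubmx N) 0 0 (drsubmx N) = N.
    rewrite -[RHS]submxK; congr block_mx; apply/matrixP => j k.
      by rewrite !mxE rs mxE !ord1 t_last (negPf (t_l _)).
    by rewrite !mxE rs mxE !ord1 t_last eq_sym (negPf (t_l _)).
  exact: pair_conj_perm.
pose d2 := \row_(k < 2) e 0 (t (lshift 1 k)).
have -> : ulsubmx N = diag_mx d2.
  apply/matrixP => j k; rewrite !mxE rs mxE (inj_eq perm_inj).
  by rewrite eqll.
apply: irreducible_diag => [k l|k l kl].
  by rewrite !mxE => /e_inj/perm_inj; apply: (@lshift_inj 2 1).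
rewrite !mxE rd model_mxE (inj_eq perm_inj) eqll (negPf kl).
by rewrite [(\col__ _) _ _]mxE add0r !cj ?t_l // mul1r mulf_neq0 // cj.
Qed.


Lemma psi_rep_irreducible z : off_lines z -> rep_irreducible (psi_rep z).
Proof.
move=> z_good; apply/(rep_irreducibleE s); rewrite smp_psi dbl_psi.
apply: irreducible_diag => // i j ij.
by rewrite model_mxE (negPf ij) add0r [const_mx _ _ _]mxE mul1r mulf_neq0 // z_good.
Qed.

(** In a basis of eigenvectors of [smp s r], rescaled so that [v] becomes the
    vector of ones, an irreducible representation is [psi_rep z] for some [z]. *)
Lemma irreducible_is_psi r : (0 < if s then n else m)%N ->
  rep_irreducible r ->
  char_poly (dbl s r) = ('X - a%:P) ^+ 2 * ('X - b%:P) ->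
  char_poly (smp s r) = \prod_i ('X - (e 0 i)%:P) ->
  exists2 z, off_lines z & rep_class r = psi z.
Proof.
move=> N_gt0 r_irr char_dbl char_smp; have /(rep_irreducibleE s) irr := r_irr.
have [k rN] := dbl_power_scalar s r_irr.
have kE : k = c.
  rewrite -a_root; apply/esym/(eigenvalue_scalar_power rN).
  by rewrite char_dbl rootE !hornerE subrr exprS !mul0r.
have a0 : a != 0.
  apply/eqP => a_eq0; have /esym/eqP := det_ab.
  by rewrite a_eq0 exprS !mul0r oner_eq0.
have [P Pu PA] : exists2 P, P \in unitmx &
    P *m dbl s r = diag_mx (\row_i (if i == ord_max then b else a)) *m P.
  apply: (diagonalize_root_of_scalar N_gt0 _ rN).
    by rewrite kE -a_root expf_neq0.
  by rewrite char_dbl !big_ord_recl big_ord0 !mxE /= mulr1 mulrA.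
have [v0 [w0 [wv0 rE]]] := model_mx_diag Pu PA.
have [Q Qu QB] := diagonalize_simple e_inj char_smp.
pose v := Q *m v0; pose w := w0 *m invmx Q.
have wv : w *m v = 1%:M by rewrite /w /v mulmxA mulmxKV.
have rM : pair_conj (dbl s r) (smp s r) (model_mx a b v w) (diag_mx e).
  by apply: (pair_conj_intro Qu) => //; rewrite rE model_mx_conj.
have irrM := pair_conj_irreducible rM irr.
clearbody v w.
have vw_neq0 i : v i 0 != 0 /\ w 0 i != 0.
  have [j ji] : exists j : 'I_3, j != i.
    by have [->|i0] := eqVneq i 0; [exists 1 | exists 0; rewrite eq_sym].
  split.
    have [_ [q [/eqP-> qi]]] := irreducible_diag_link irrM (eqxx i : pred1 i i) ji.
    rewrite /= in qi; rewrite model_mxE [i == q]eq_sym (negPf qi) add0r.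
    by apply: contraNneq => ->; rewrite mul0r mulr0.
  have ii : ~~ predC1 i i by rewrite /= eqxx.
  have [p [q [/= pi + Apq]]] := irreducible_diag_link irrM (ji : predC1 i j) ii.
  rewrite /= negbK => /eqP qi; move: Apq; rewrite qi model_mxE (negPf pi) add0r.
  by apply: contraNneq => ->; rewrite !mulr0.
pose t : 'rV[C]_3 := \row_i (v i 0 * w 0 i).
have t1 : t *m (const_mx 1 : 'cV_3) = 1%:M.
  rewrite -wv; apply/matrixP => i j; rewrite !ord1 [LHS]mxE [RHS]mxE.
  by apply: eq_bigr => l _; rewrite !mxE mulr1 mulrC.
pose z : 'rV[C]_2 := plane_point (t 0 0) (t 0 1).
have tE : coords z = t by rewrite /coords ![z _ _]mxE /= -bary_of_sum1.
exists z => [i|].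
  by rewrite tE mxE mulf_neq0 //; have [] := vw_neq0 i.
apply/esym/rep_class_conj/(rep_conjE s); apply: pair_conj_trans (pair_conj_sym rM).
rewrite dbl_psi smp_psi tE.
apply: (model_mx_rescale _ _ _ (u := fun i => v i 0)) => i.
- by have [] := vw_neq0 i.
- by rewrite mxE mulr1.
- by rewrite mxE mulrC.
Qed.

Lemma irreducible_locus_psi : (0 < if s then n else m)%N ->
  @rep_class R m n @` [set r | [/\ rep_irreducible r,
    char_poly (dbl s r) = ('X - a%:P) ^+ 2 * ('X - b%:P)
    & char_poly (smp s r) = \prod_i ('X - (e 0 i)%:P)]] = psi @` off_lines.
Proof.
move=> N_gt0; apply/seteqP; split=> [_ [r [irr rd rs] <-]|_ [z z_good <-]].
  by have [z z_good ->] := irreducible_is_psi N_gt0 irr rd rs; exists z.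
exists (psi_rep z) => //; split; first exact: psi_rep_irreducible.
  by rewrite dbl_psi char_poly_model_mx // coords_sum.
by rewrite smp_psi char_poly_diag_e.
Qed.

End Parametrization.

(** * The triangle of reducible representations *)

Section Triangle.
Variable R : realType.
Local Notation C := R[i].
Implicit Type z : 'rV[C]_2.

Lemma ord3_cases (i : 'I_3) : [\/ i = 0, i = 1 | i = inord 2].
Proof.
case: i => -[|[|[|]]] //= ilt; [apply: Or31|apply: Or32|apply: Or33];
  by apply: val_inj; rewrite //= inordK.
Qed.

Lemma coords0 z : coords z 0 0 = z 0 0. Proof. by rewrite mxE. Qed.
Lemma coords1 z : coords z 0 1 = z 0 1. Proof. by rewrite mxE. Qed.
Lemma coords2 z : coords z 0 (inord 2) = 1 - z 0 0 - z 0 1.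
Proof. by rewrite mxE inordK. Qed.

Lemma line_xyE z : line_xy z <-> coords z 0 (inord 2) = 0.
Proof.
rewrite coords2 -addrA -opprD; split=> [->|/eqP]; first by rewrite subrr.
by rewrite subr_eq0 => /eqP.
Qed.

Lemma linesE :
  line_x `|` line_y `|` line_xy = [set z : 'rV[C]_2 | exists i, coords z 0 i = 0].
Proof.
apply/seteqP; split=> [z [[z0|z1]|/line_xyE z2] | z [k zk]].
- by exists 0; rewrite coords0.
- by exists 1; rewrite coords1.
- by exists (inord 2).
move: zk; case: (ord3_cases k) => ->; rewrite ?coords0 ?coords1 => zk.
- by left; left.
- by left; right.
- by right; apply/line_xyE.
Qed.

Lemma verticesE :
  line_x `&` line_y `|` line_x `&` line_xy `|` line_y `&` line_xy =
  [set z : 'rV[C]_2 | exists i j, [/\ i != j, coords z 0 i = 0 & coords z 0 j = 0]].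
Proof.
apply/seteqP; split=> [z [[[zi zj] | [zi /line_xyE zj]] | [zi /line_xyE zj]] | ].
- by exists 0, 1; rewrite coords0 coords1.
- by exists 0, (inord 2); rewrite coords0 -val_eqE /= inordK.
- by exists 1, (inord 2); rewrite coords1 -val_eqE /= inordK.
move=> z [i [j [ij]]]; case: (ord3_cases i) ij => ->; case: (ord3_cases j) => ->;
  rewrite ?eqxx //= => _;
  rewrite ?coords0 ?coords1 => zi zj.
- by left; left; split.
- by left; right; split=> //; apply/line_xyE.
- by left; left; split.
- by right; split=> //; apply/line_xyE.
- by left; right; split=> //; apply/line_xyE.
- by right; split=> //; apply/line_xyE.
Qed.

Lemma vertices_products :
  [set z : 'rV[C]_2 | exists i j, [/\ i != j, coords z 0 i = 0 & coords z 0 j = 0]] =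
  [set z : 'rV[C]_2 | forall i j, i != j -> coords z 0 i * coords z 0 j = 0].
Proof.
apply/seteqP; split=> z /=.
  move=> [i [j [ij zi zj]]] p q pq.
  have [pi|pi] := eqVneq p i; first by rewrite pi zi mul0r.
  have [qi|qi] := eqVneq q i; first by rewrite qi zi mulr0.
  have [pj|pj] := eqVneq p j; first by rewrite pj zj mul0r.
  suff -> : q = j by rewrite zj mulr0.
  apply/eqP; move: ij pq pi qi pj {zi zj}; rewrite -!val_eqE.
  by case: i j p q => -[|[|[|]]] // ? [[|[|[|]]] // ?] [[|[|[|]]] // ?] [[|[|[|]]] // ?].
move=> zz; have n01 : 0 != 1 :> 'I_3 by [].
have n02 : 0 != inord 2 :> 'I_3 by rewrite -val_eqE /= inordK.
have n12 : 1 != inord 2 :> 'I_3 by rewrite -val_eqE /= inordK.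
have /eqP := zz _ _ n01; rewrite mulf_eq0 => /orP[/eqP z0|/eqP z1].
  have /eqP := zz _ _ n12; rewrite mulf_eq0 => /orP[/eqP z1|/eqP z2].
    by exists 0, 1.
  by exists 0, (inord 2).
have /eqP := zz _ _ n02; rewrite mulf_eq0 => /orP[/eqP z0|/eqP z2].
  by exists 0, 1.
by exists 1, (inord 2).
Qed.

Lemma plane_pointP z (x y : C) : z 0 0 = x -> z 0 1 = y -> z = plane_point x y.
Proof.
move=> <- <-; apply/rowP => -[[|[|]] // jlt]; rewrite mxE /=;
by congr (z _ _); apply: val_inj.
Qed.

Lemma line_intersections :
  [/\ line_x `&` line_y = [set plane_point (0 : C) 0],
      line_x `&` line_xy = [set plane_point (0 : C) 1]
    & line_y `&` line_xy = [set plane_point (1 : C) 0]].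
Proof.
split; apply/seteqP; split=> [z [zi zj] | z ->] /=; rewrite /line_x /line_y /line_xy /=.
- exact: plane_pointP.
- by rewrite !mxE.
- by apply: plane_pointP => //; move: zj; rewrite /line_xy /= zi add0r.
- by rewrite !mxE add0r.
- by apply: plane_pointP => //; move: zj; rewrite /line_xy /= zi addr0.
- by rewrite !mxE addr0.
Qed.

End Triangle.

(** The constraints on the eigenvalues that make [psi] well defined, such as
    [a ^ n = b ^ n], hold because some irreducible representation has these
    eigenvalues. *)
Lemma component_closure (R : realType) (m n : nat) (s : bool) (a b : R[i])
    (e : 'rV[R[i]]_3) (X : set (char_variety R m n)) :
  (0 < if s then n else m)%N -> a != b -> injective (e 0) ->
  X = @rep_class R m n @` [set r | [/\ rep_irreducible r,
    char_poly (dbl s r) = ('X - a%:P) ^+ 2 * ('X - b%:P)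
    & char_poly (smp s r) = \prod_i ('X - (e 0 i)%:P)]] ->
  X !=set0 ->
  exists phi : char_variety R m n -> 'rV[R[i]]_2,
    [/\ affine_plane_iso (zariski_closure X) phi,
        phi @` X = ~` (line_x `|` line_y `|` line_xy),
        phi @` (zariski_closure X `\` X) = line_x `|` line_y `|` line_xy,
        phi @` (zariski_closure X `&` @partially_reducible_points R m n) =
          (line_x `|` line_y `|` line_xy) `\`
          (line_x `&` line_y `|` line_x `&` line_xy `|` line_y `&` line_xy)
      & phi @` (zariski_closure X `&` @totally_reducible_points R m n) =
          line_x `&` line_y `|` line_x `&` line_xy `|` line_y `&` line_xy].
Proof.
move=> N_gt0 ab e_inj XE; rewrite XE => -[_ [r0 [irr0 rd0 rs0] _]].
have [c r0N] := dbl_power_scalar s irr0.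
have a_root : a ^+ (if s then n else m) = c.
  apply: (eigenvalue_scalar_power r0N).
  by rewrite rd0 rootE !hornerE subrr exprS !mul0r.
have b_root : b ^+ (if s then n else m) = c.
  by apply: (eigenvalue_scalar_power r0N); rewrite rd0 rootE !hornerE subrr mulr0.
have e_root (i : 'I_3) : e 0 i ^+ (if s then m else n) = c.
  rewrite dbl_smp_rel in r0N; apply: (eigenvalue_scalar_power r0N).
  by rewrite rs0 rootE horner_prod (bigD1 i) //= !hornerE subrr mul0r.
have det_ab : a ^+ 2 * b = 1.
  rewrite -(det_dbl s r0) (@det_spectrum _ _ _ (\row_i (if i == ord_max then b else a))).
    by rewrite !big_ord_recl big_ord0 !mxE /= mulr1 mulrA.
  by rewrite rd0 !big_ord_recl big_ord0 !mxE /= mulr1 mulrA.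
have det_e : \prod_i e 0 i = 1 := etrans (esym (det_spectrum rs0)) (det_smp s r0).
pose psi := psi det_ab det_e a_root b_root e_root.
pose phi := phi ab e_inj det_ab det_e a_root b_root e_root.
have phiK : cancel psi phi by exact: psiK.
have phi_psi (Q : set (char_variety R m n)) : phi @` (range psi `&` Q) = psi @^-1` Q.
  apply/seteqP; split=> [_ [_ [[z _ <-] Qz] <-]|z Qz]; first by rewrite phiK.
  by exists (psi z); rewrite ?phiK //; split=> //; exists z.
have off_linesE : @off_lines R = ~` (line_x `|` line_y `|` line_xy).
  rewrite linesE; apply/seteqP; split=> z zgood.
    by move=> [k zk]; have := zgood k; rewrite zk eqxx.
  by move=> k; apply/eqP => zk; apply: zgood; exists k.
have psiX : psi @^-1` (psi @` @off_lines R) = @off_lines R.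
  apply/seteqP; split=> [z [z' z'good /(can_inj phiK) <-]|z zgood] //.
  by exists z.
have partE := psi_partially_reducible ab e_inj det_ab det_e a_root b_root e_root.
have totE := psi_totally_reducible ab e_inj det_ab det_e a_root b_root e_root.
exists phi; rewrite (irreducible_locus_psi ab e_inj det_ab det_e a_root b_root e_root N_gt0).
rewrite (closure_psi ab e_inj); split.
- exact: psi_plane_iso.
- rewrite -off_linesE -[RHS]psiX -phi_psi; congr (phi @` _).
  by apply/seteqP; split=> [x [z zgood <-]|x [] //]; split; exists z.
- by rewrite setDE phi_psi -preimage_setC psiX off_linesE setCK.
- rewrite phi_psi linesE verticesE; apply/seteqP; split=> z /=.
    move=> /partE[k [zk z_neq0]]; split; first by exists k.
    move=> [p [q [pq zp zq]]]; move: pq.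
    have only_k l : coords z 0 l = 0 -> l = k.
      by move=> zl; apply/eqP; apply: contraT => /z_neq0; rewrite zl eqxx.
    by rewrite (only_k _ zp) (only_k _ zq) eqxx.
  move=> [[k zk] z_simple]; apply/partE; exists k; split=> // l lk.
  by apply/eqP => zl; apply: z_simple; exists l, k.
- rewrite phi_psi verticesE vertices_products; apply/seteqP.
  by split=> z /totE.
Qed.

Theorem proposition9p3 (R : realType) (m n : nat)
    (m_gt0 : (0 < m)%N) (n_gt0 : (0 < n)%N) (coprime_mn : coprime m n)
    (X : set (char_variety R m n)) (X_component : two_dim_component X) :
  exists phi : char_variety R m n -> 'rV[R[i]]_2,
    [/\ affine_plane_iso (zariski_closure X) phi,
        phi @` X = ~` (line_x `|` line_y `|` line_xy),
        phi @` (zariski_closure X `\` X) = line_x `|` line_y `|` line_xy,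
        phi @` (zariski_closure X `&` @partially_reducible_points R m n) =
          (line_x `|` line_y `|` line_xy) `\`
          (line_x `&` line_y `|` line_x `&` line_xy `|` line_y `&` line_xy)
      & phi @` (zariski_closure X `&` @totally_reducible_points R m n) =
          line_x `&` line_y `|` line_x `&` line_xy `|` line_y `&` line_xy] /\
    [/\ line_x `&` line_y = [set plane_point (0 : R[i]) 0],
        line_x `&` line_xy = [set plane_point (0 : R[i]) 1]
      & line_y `&` line_xy = [set plane_point (1 : R[i]) 0]].
Proof.
have [alpha [beta [eigs XE X0]]] := X_component.
have double (t : 3.-tuple R[i]) a b : perm_eq t [:: a; a; b] ->
    \prod_(x <- t) ('X - x%:P) = ('X - a%:P) ^+ 2 * ('X - b%:P).
  by move=> t_ab; rewrite (perm_big _ t_ab) /= !big_cons big_nil mulr1 mulrA.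
have simple (t : 3.-tuple R[i]) : uniq t ->
    let d := \row_i tnth t i in injective (d 0) /\
    \prod_(x <- t) ('X - x%:P) = \prod_i ('X - (d 0 i)%:P).
  move=> /tuple_uniqP t_inj d; split=> [i j|]; first by rewrite !mxE => /t_inj.
  by rewrite big_tuple; apply: eq_bigr => i _; rewrite mxE.
have [s [a [b [e [N_gt0 ab e_inj {}XE]]]]] : exists s a b (e : 'rV[R[i]]_3),
    [/\ (0 < if s then n else m)%N, a != b, injective (e 0)
      & X = @rep_class R m n @` [set r | [/\ rep_irreducible r,
          char_poly (dbl s r) = ('X - a%:P) ^+ 2 * ('X - b%:P)
          & char_poly (smp s r) = \prod_i ('X - (e 0 i)%:P)]]].
  case: eigs XE => [[[a [b [ab alphaE]]] /simple[]]|[/simple[] + + [a [b [ab betaE]]]]].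
    move=> e_inj betaE XE; exists true, a, b, (\row_i tnth beta i); split=> //.
    by rewrite XE /irreducible_points /has_eigenvalues betaE (double _ _ _ alphaE).
  move=> e_inj alphaE XE; exists false, a, b, (\row_i tnth alpha i); split=> //.
  rewrite XE /irreducible_points /has_eigenvalues alphaE (double _ _ _ betaE).
  by congr (_ @` _); apply/seteqP; split=> r [].
have [phi phiP] := component_closure N_gt0 ab e_inj XE X0.
by exists phi; split; [exact: phiP | exact: line_intersections].
Qed.
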